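(* Let $A \in \mathbb{R}^{n\times n}$ be symmetric positive definite with a partial Cholesky factorization, for some $1 \le k < n$, $$\Pi^T A \Pi = L L^T + \begin{pmatrix} 0 & 0 \\ 0 & S \end{pmatrix}, \qquad L = \begin{pmatrix} L_{11} \\ \ell^T \\ L_{21} \end{pmatrix}, \qquad S = \begin{pmatrix} \alpha & s^T \\ s & \widehat{S} \end{pmatrix},$$ where $\Pi$ is an $n\times n$ permutation matrix, $L_{11}\in\mathbb{R}^{k\times k}$, $\ell\in\mathbb{R}^{k\times 1}$, $L_{21}\in\mathbb{R}^{(n-k-1)\times k}$, $\alpha\in\mathbb{R}$, $s\in\mathbb{R}^{(n-k-1)\times 1}$, and $\widehat{S}\in\mathbb{R}^{(n-k-1)\times(n-k-1)}$. Assume that $\alpha = \|S\|_{\max}$ and that, for a given $g>1$, $$\frac{1}{\sqrt{\alpha}} \;\ge\; \frac{1}{\sqrt{g}} \left\| \begin{pmatrix} L_{11} & 0 \\ \ell^T & \sqrt{\alpha} \end{pmatrix}^{-1} \right\|_{2,1}.$$ Then there exists a real number $\tau \le g(n-k)(k+1)$ such that $$\lambda_{k+1}(A) \;\le\; \left\| \Pi^T A \Pi - L L^T \right\|_2 \;\le\; \tau\, \lambda_{k+1}(A),$$ and, for all $1 \le j \le k$, $$\lambda_j(A) \;\ge\; \sigma_j^2(L) \;\ge\; \frac{\lambda_j(A)}{1+\tau \min\left\{1,\; (1+\tau)\dfrac{\lambda_{k+1}(A)}{\lambda_j(A)}\right\}}.$$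
   Context: For a real matrix $X$, $\sigma_j(X)$ denotes its $j$-th largest singular value; for a real symmetric matrix $X$, $\lambda_j(X)$ denotes its $j$-th largest eigenvalue. $\|X\|_2$ is the spectral norm. $\|X\|_{2,1}$ is the largest of the Euclidean norms of the columns of $X$. $\|X\|_{\max}$ is the largest absolute value of an entry of $X$. A partial Cholesky factorization (after $k$ steps, with diagonal pivoting given by a permutation matrix $\Pi$) of a symmetric positive definite $A\in\mathbb{R}^{n\times n}$ is a factorization of the displayed form in which $L\in\mathbb{R}^{n\times k}$, the leading $k\times k$ block $L_{11}$ is lower triangular with positive diagonal entries (the Cholesky factor of the leading $k\times k$ block of $\Pi^TA\Pi$), and $S\in\mathbb{R}^{(n-k)\times(n-k)}$ is the corresponding Schur complement, which is symmetric positive definite. The zero blocks in the factorization are of the sizes that make $S$ occupy the trailing $(n-k)\times(n-k)$ block. When $k=n-1$, the blocks $L_{21}$, $s$, $\widehat{S}$ are empty. *)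

(* Defs.v *)
From mathcomp Require Import all_boot all_order all_algebra.
From mathcomp Require Import complex.
From mathcomp Require Import boolp classical_sets reals matrix_normedtype.

Set Implicit Arguments.
Unset Strict Implicit.
Unset Printing Implicit Defensive.

Import Order.TTheory GRing.Theory Num.Theory.
Local Open Scope ring_scope.
Local Open Scope classical_set_scope.

(* The eigenvalues listed in nonincreasing order with algebraic multiplicity.
   The list is empty when the characteristic polynomial does not split over R,
   which by eigvalsP does not happen for symmetric matrices. *)
Definition eigvals (R : realType) n (X : 'M[R]_n) : seq R :=
  xget [::] [set s | sorted >=%O s /\
                     char_poly X = \prod_(x <- s) ('X - x%:P)].

Lemma eigvalsP (R : realType) n (X : 'M[R]_n) : X^T = X ->
  [/\ sorted >=%O (eigvals X), size (eigvals X) = n &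
      char_poly X = \prod_(x <- eigvals X) ('X - x%:P)].
Proof.
move=> symX.
suff [s [sos Es]] : exists s : seq R, sorted >=%O s /\
    char_poly X = \prod_(x <- s) ('X - x%:P).
  have [so E] : sorted >=%O (eigvals X) /\
      char_poly X = \prod_(x <- eigvals X) ('X - x%:P).
    by rewrite /eigvals; case: xgetP => [t _ //|/(_ s)] [].
  split=> //; apply/eqP; rewrite -eqSS -(size_prod_XsubC (eigvals X) id).
  by rewrite -E size_char_poly.
pose f := real_complex R; pose B := map_mx f X.
have hB : B \is hermsymmx.
  apply/is_hermitianmxP; rewrite expr0 scale1r.
  apply/matrixP => i j; rewrite !mxE -[in LHS]symX mxE.
  by apply/esym/CrealP; rewrite complex_real.
pose d := spectral_diag B; pose r := \row_i complex.Re (d 0 i).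
have dr : d = map_mx f r.
  apply/rowP => i; rewrite !mxE; apply/esym/RRe_real.
  exact: (mxOverP (hermitian_spectral_diag_real hB)).
have EB : char_poly B = char_poly (diag_mx d).
  have /orthomx_spectralP -> := hermitian_normalmx hB.
  rewrite /char_poly /char_poly_mx -/d; set Q := spectralmx B.
  have uQ : Q \in unitmx by exact: spectral_unit.
  have QQ : map_mx polyC (invmx Q) *m map_mx polyC Q = 1%:M :> 'M[{poly R[i]}]_n.
    by rewrite -map_mxM mulVmx // map_mx1.
  have -> : 'X%:M - map_mx polyC (invmx Q *m diag_mx d *m Q) =
      map_mx polyC (invmx Q) *m ('X%:M - map_mx polyC (diag_mx d))
        *m map_mx polyC Q.
    rewrite !map_mxM mulmxBr mulmxBl; congr (_ - _).
    by rewrite scalar_mxC -mulmxA QQ mulmx1.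
  rewrite !det_mulmx mulrC mulrA -det_mulmx.
  by rewrite -map_mxM mulmxV // map_mx1 det1 mul1r.
have EX : char_poly X = \prod_(i < n) ('X - (r 0 i)%:P).
  apply: (map_poly_inj f); rewrite map_char_poly -/B EB.
  rewrite char_poly_trig ?diag_mx_is_trig // rmorph_prod /=.
  apply: eq_bigr => i _; rewrite mxE eqxx mulr1n.
  by rewrite rmorphB /= map_polyX map_polyC dr mxE.
exists (sort >=%O [seq r 0 i | i <- enum 'I_n]); split.
  by apply: sort_sorted => x y; exact: le_total.
rewrite EX (perm_big [seq r 0 i | i <- enum 'I_n]) /=; last by rewrite perm_sort.
by rewrite big_map big_enum.
Qed.

(* The index is 1-based: eigval 1 X is the largest eigenvalue of X. *)
Definition eigval (R : realType) (j : nat) n (X : 'M[R]_n) : R :=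
  (eigvals X)`_j.-1.

Definition singval (R : realType) (j : nat) m n (X : 'M[R]_(m, n)) : R :=
  Num.sqrt (eigval j (X^T *m X)).

Definition norm2 (R : realType) n (v : 'cV[R]_n) : R :=
  Num.sqrt (\sum_i v i 0 ^+ 2).

Definition spectral_norm (R : realType) m n (X : 'M[R]_(m, n)) : R :=
  sup [set norm2 (X *m v) | v in [set v : 'cV[R]_n | norm2 v <= 1]].

Definition norm21 (R : realType) m n (X : 'M[R]_(m, n)) : R :=
  \big[Num.max/0]_(j < n) norm2 (col j X).

Definition sym_posdef (R : realType) n (X : 'M[R]_n) : Prop :=
  X^T = X /\ forall v : 'cV[R]_n, v != 0 -> 0 < (v^T *m X *m v) 0 0.

(* The block equation makes usubmx L the Cholesky factor of the leading block
   of P^T A P, and S its Schur complement. *)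
Definition partial_cholesky (R : realType) k m (A P : 'M[R]_(k + m))
    (L : 'M[R]_(k + m, k)) (S : 'M[R]_m) : Prop :=
  [/\ is_perm_mx P,
      is_trig_mx (usubmx L),
      forall i, 0 < usubmx L i i,
      sym_posdef S &
      P^T *m A *m P = L *m L^T + block_mx 0 0 0 S].

(* Main.v *)
Require Import Defs.
From mathcomp Require Import all_boot all_order all_fingroup all_algebra.
From mathcomp Require Import ring lra zify.
From mathcomp Require Import classical_sets reals matrix_normedtype.

Set Implicit Arguments.
Unset Strict Implicit.
Unset Printing Implicit Defensive.

Import Order.TTheory GRing.Theory Num.Theory.
Local Open Scope ring_scope.

(* Take tau = g (n - k) (k + 1). The matrix M of the pivot condition satisfies
   M M^T = the leading (k+1)-block of P^T A P, and |M^-1|_F^2 <= (k + 1) g / alpha,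
   so every squared singular value of M is at least c = alpha / (g (k + 1)).
   By interlacing, c bounds from below both lambda_(k+1)(A) and the squared
   singular values of L, while |S|_2 <= (n - k) alpha = tau c. Weyl's inequality
   lambda_j(A) <= sigma_j(L)^2 + |S|_2 then yields both alternatives of the
   minimum, the second one being bootstrapped from the first.
   All eigenvalue comparisons go through the Courant-Fischer principle, obtained
   from a real spectral theorem by deflation with Householder reflections. *)

(** * The Euclidean inner product on row vectors *)

Definition dot (R : realType) n (u v : 'rV[R]_n) : R := (u *m v^T) 0 0.

Lemma dotE (R : realType) n (u v : 'rV[R]_n) :
  dot u v = \sum_i u 0 i * v 0 i.
Proof. by rewrite /dot mxE; apply: eq_bigr => i _; rewrite mxE. Qed.

Lemma dotC (R : realType) n (u v : 'rV[R]_n) : dot u v = dot v u.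
Proof. by rewrite !dotE; apply: eq_bigr => i _; rewrite mulrC. Qed.

Lemma dotDl (R : realType) n (u v w : 'rV[R]_n) :
  dot (u + v) w = dot u w + dot v w.
Proof. by rewrite /dot mulmxDl mxE. Qed.

Lemma dotZl (R : realType) n a (u v : 'rV[R]_n) : dot (a *: u) v = a * dot u v.
Proof. by rewrite /dot -scalemxAl mxE. Qed.

Lemma dot0l (R : realType) n (u : 'rV[R]_n) : dot 0 u = 0.
Proof. by rewrite /dot mul0mx mxE. Qed.

Lemma dot_mull (R : realType) m n (u : 'rV[R]_m) (X : 'M[R]_(m, n)) v :
  dot (u *m X) v = dot u (v *m X^T).
Proof. by rewrite /dot trmx_mul trmxK mulmxA. Qed.

Lemma dot_row_mx (R : realType) m n (u u' : 'rV[R]_m) (v v' : 'rV[R]_n) :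
  dot (row_mx u v) (row_mx u' v') = dot u u' + dot v v'.
Proof. by rewrite /dot tr_row_mx mul_row_col mxE. Qed.

Lemma dot_ge0 (R : realType) n (u : 'rV[R]_n) : 0 <= dot u u.
Proof. by rewrite dotE sumr_ge0 // => i _; rewrite -expr2 sqr_ge0. Qed.

Lemma dot_eq0 (R : realType) n (u : 'rV[R]_n) : (dot u u == 0) = (u == 0).
Proof.
apply/idP/eqP => [|->]; last by rewrite dot0l.
rewrite dotE psumr_eq0 => [/allP u0|i _]; last by rewrite -expr2 sqr_ge0.
apply/rowP => i; rewrite mxE; apply/eqP.
by have := u0 i (mem_index_enum _); rewrite mulf_eq0 orbb.
Qed.

Lemma dot_gt0 (R : realType) n (u : 'rV[R]_n) : (0 < dot u u) = (u != 0).
Proof. by rewrite lt0r dot_eq0 dot_ge0 andbT. Qed.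

Lemma dot_CauchySchwarz (R : realType) n (u v : 'rV[R]_n) :
  dot u v ^+ 2 <= dot u u * dot v v.
Proof.
have [->|u0] := eqVneq u 0; first by rewrite !dot0l expr0n mul0r.
have a0 : 0 < dot u u by rewrite dot_gt0.
(* With [a], [b], [c] as set below, the squared norm of [a v - b u] is [a (a c - b^2)], and [a] is
   positive. *)
have := dot_ge0 (dot u u *: v + - dot u v *: u).
rewrite !dotDl !dotZl !(dotC _ (_ + _)) !dotDl !dotZl (dotC v u).
set a := dot u u; set b := dot u v; set c := dot v v => h.
have : 0 <= a * (a * c - b ^+ 2) by move: h; congr (_ <= _); ring.
by rewrite pmulr_rge0 // subr_ge0.
Qed.

(** * Householder reflections and the real spectral theorem *)

Lemma householder (R : realType) n (u v : 'rV[R]_n) : dot u u = dot v v ->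
  exists H : 'M[R]_n, [/\ H^T = H, H *m H = 1%:M & v *m H = u].
Proof.
move=> uv; pose w := u - v.
have [/eqP w0|w0] := eqVneq w 0.
  exists 1%:M; rewrite trmx1 mulmx1 mulmx1; split=> //.
  by move: w0; rewrite subr_eq0 => /eqP.
pose c := 2 / dot w w; pose K := w^T *m w.
have d0 : dot w w != 0 by rewrite dot_eq0.
have wK x : x *m K = dot x w *: w.
  by rewrite /K mulmxA [x *m _]mx11_scalar mul_scalar_mx.
have KT : K^T = K by rewrite /K trmx_mul trmxK.
(* The reflection in the hyperplane orthogonal to [w = u - v], which swaps [u] and [v]. *)
exists (1%:M - c *: K); split.
- by rewrite linearB /= linearZ /= trmx1 KT.
- have KK : K *m K = dot w w *: K.
    by rewrite {1}/K -mulmxA wK -scalemxAr.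
  rewrite mulmxBl mul1mx mulmxBr mulmx1 -scalemxAl -scalemxAr KK !scalerA.
  have -> : c * c * dot w w = c + c.
    by rewrite /c; field.
  by rewrite scalerDl opprB addrK subrK.
- rewrite mulmxBr mulmx1 -scalemxAr wK scalerA.
  have -> : c * dot v w = -1.
    (* Equality of the norms of [u] and [v] enters here. *)
    have e : dot w w = - (2 * dot v w).
      rewrite /w !(dotC _ (_ - _)) !dotDl -scaleN1r !dotZl.
      rewrite !(dotC _ (_ + _)) !dotDl !dotZl.
      by rewrite uv (dotC v u); ring.
    have b0 : dot v w != 0 by apply: contraNneq d0 => b0; rewrite e b0 mulr0 oppr0.
    rewrite /c e; field; exact: b0.
  by rewrite scaleN1r opprK addrC subrK.
Qed.

Lemma char_poly_conj (R : comNzRingType) n (X Y Z : 'M[R]_n) : Y *m Z = 1%:M ->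
  char_poly (Y *m X *m Z) = char_poly X.
Proof.
move=> YZ; rewrite /char_poly /char_poly_mx.
have YZ' : map_mx polyC Y *m map_mx polyC Z = 1%:M :> 'M[{poly R}]_n.
  by rewrite -map_mxM YZ map_mx1.
have -> : 'X%:M - map_mx polyC (Y *m X *m Z) =
    map_mx polyC Y *m ('X%:M - map_mx polyC X) *m map_mx polyC Z.
  by rewrite !map_mxM mulmxBr mulmxBl scalar_mxC -(mulmxA _%:M) YZ' mulmx1.
by rewrite !det_mulmx mulrC mulrA -det_mulmx (mulmx1C YZ') det1 mul1r.
Qed.

Lemma char_poly_block_diag (R : comNzRingType) m n (X : 'M[R]_m) (Y : 'M[R]_n) :
  char_poly (block_mx X 0 0 Y) = char_poly X * char_poly Y.
Proof.
rewrite /char_poly /char_poly_mx map_block_mx !map_mx0 scalar_mx_block.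
by rewrite opp_block_mx add_block_mx !oppr0 !addr0 det_ublock.
Qed.

(** A reflection sends a unit eigenvector to the first basis vector, which splits off a 1 x 1 block;
    induction treats the rest. The diagonal keeps the order of [s], so with [s = eigvals X] it is
    sorted. *)
Lemma real_spectral (R : realType) n (X : 'M[R]_n) (s : seq R) :
  X^T = X -> char_poly X = \prod_(x <- s) ('X - x%:P) ->
  exists2 Q : 'M[R]_n, Q *m Q^T = 1%:M &
    Q *m X *m Q^T = diag_mx (\row_i s`_i).
Proof.
elim: n => [|n IHn] in X s *; first by exists 0; apply/matrixP=> - [].
move=> symX; case: s => [|x s] EX.
  have := size_char_poly X.
  by rewrite EX big_nil size_poly1.
have rx : root (char_poly X) x by rewrite EX big_cons rootM root_XsubC eqxx.
have [v vX v0] : exists2 v : 'rV_n.+1, v *m X = x *: v & v != 0.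
  by apply/eigenvalueP; rewrite eigenvalue_root_char.
have vv : 0 < dot v v by rewrite dot_gt0.
pose u := (Num.sqrt (dot v v))^-1 *: v.
pose e : 'rV[R]_(1 + n) := row_mx 1%:M 0.
have ue : dot u u = dot e e.
  rewrite dot_row_mx dot0l addr0 /u dotZl dotC dotZl mulrA -expr2.
  rewrite exprVn sqr_sqrtr ?ltW //.
  by rewrite mulVf ?gt_eqF // /dot trmx1 mulmx1 mxE.
have uX : u *m X = x *: u by rewrite /u -scalemxAl vX !scalerA mulrC.
have [H [HT HH eH]] := householder ue.
have [Y [YT EY]] : exists Y : 'M[R]_n, Y^T = Y /\
    H *m X *m H = (block_mx x%:M 0 0 Y : 'M_(1 + n)).
  pose Z : 'M[R]_(1 + n) := H *m X *m H.
  have ZT : Z^T = Z by rewrite /Z !trmx_mul HT symX mulmxA.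
  (* As [H] swaps [e] and [u], the first row of [Z] is [x e]; symmetry then clears the rest of the
     first column. *)
  have eZ : e *m Z = x *: e.
    by rewrite /Z !mulmxA eH uX -scalemxAl -eH -mulmxA HH mulmx1.
  move: eZ; rewrite -[Z]submxK mul_row_block !mul1mx !mul0mx !addr0 scale_row_mx.
  move=> /eq_row_mx [ul ur].
  have dl : dlsubmx Z = 0.
    by rewrite -ZT -trmx_ursub ur scaler0 trmx0.
  exists (drsubmx Z); split; first by rewrite trmx_drsub ZT.
  by rewrite -/Z -{1}[Z]submxK ul ur dl scaler0 scalemx1.
have EYs : char_poly Y = \prod_(y <- s) ('X - y%:P).
  have : char_poly (H *m X *m H) = char_poly X by apply: char_poly_conj.
  rewrite EY (@char_poly_block_diag _ 1 n) EX big_cons.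
  rewrite char_poly_trig ?scalar_mx_is_trig // big_ord1 mxE mulr1n.
  by apply: mulfI; rewrite polyXsubC_eq0.
have [Q QQ QY] := IHn Y s YT EYs.
pose B : 'M[R]_(1 + n) := block_mx 1%:M 0 0 Q.
have BT : B^T = block_mx 1%:M 0 0 Q^T by rewrite /B tr_block_mx !trmx0 trmx1.
have BB : B *m B^T = 1%:M.
  rewrite BT mulmx_block !mul0mx !mulmx0 !addr0 !add0r QQ mulmx1.
  by rewrite -scalar_mx_block.
have BYB : B *m block_mx x%:M 0 0 Y *m B^T = block_mx x%:M 0 0 (Q *m Y *m Q^T).
  by rewrite BT !mulmx_block !(mul0mx, mulmx0, addr0, add0r) mul1mx mulmx1.
exists (B *m H : 'M_n.+1).
  by rewrite trmx_mul HT mulmxA -(mulmxA B) HH mulmx1.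
rewrite trmx_mul HT.
have -> : B *m H *m X *m (H *m B^T) = B *m (H *m X *m H) *m B^T.
  by rewrite !mulmxA.
rewrite EY BYB QY.
transitivity (diag_mx (row_mx x%:M (\row_i s`_i)) : 'M[R]_(1 + n)).
  have D1 : diag_mx (x%:M : 'rV_1) = x%:M.
    by apply/matrixP => i j; rewrite !ord1 !mxE.
  by rewrite diag_mx_row D1.
congr diag_mx; apply/rowP => i; rewrite !mxE; case: splitP => j -> //.
  by rewrite ord1 mxE.
by rewrite mxE.
Qed.

(** * Courant-Fischer bounds *)

Lemma rows_intersect (F : fieldType) p q n (V : 'M[F]_(p, n)) (U : 'M[F]_(q, n)) :
  row_free V -> row_free U -> (n < p + q)%N ->
  exists (w : 'rV_p) (w' : 'rV_q), w *m V = w' *m U /\ w *m V != 0.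
Proof.
move=> /eqP fV /eqP fU lt.
have : (V :&: U)%MS != 0.
  rewrite -mxrank_eq0 -lt0n; have := mxrank_sum_cap V U.
  have := rank_leq_col (V + U)%MS; rewrite fV fU.
  move=> h1 h2; lia.
case/rowV0Pn => v; rewrite sub_capmx => /andP[/submxP [w Ew] /submxP [w' Ew']] v0.
by exists w, w'; rewrite -Ew -Ew'.
Qed.

Lemma eigval_noninc (R : realType) n (X : 'M[R]_n) i j : X^T = X ->
  (i <= j)%N -> (j <= n)%N -> eigval j X <= eigval i X.
Proof.
move=> /eigvalsP [so sz _] ij; case: n => [|n] in X so sz *.
  by rewrite leqn0 => /eqP j0; move: ij; rewrite j0 leqn0 => /eqP ->.
move=> jn; rewrite /eigval.
have tr : transitive (>=%O : rel R) by move=> ? ? ? h1 h2; exact: le_trans h2 h1.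
apply: (sorted_leq_nth tr (@lexx _ R) 0 so); rewrite ?inE ?sz; lia.
Qed.

(** The rows are orthonormal eigenvectors, numbered [a + 1] to [a + p]. The offset gives the leading
    ones for [a = 0] and the trailing ones for [a = j - 1]. *)
Lemma eigval_rows (R : realType) n (X : 'M[R]_n) a p : X^T = X ->
  (a + p <= n)%N ->
  exists2 V : 'M[R]_(p, n), row_free V &
    forall w, dot (w *m V) (w *m V) = dot w w /\
      dot (w *m V *m X) (w *m V) = \sum_(i < p) eigval (a + i).+1 X * w 0 i ^+ 2.
Proof.
move=> symX ap; have [_ _ EX] := eigvalsP symX.
have [Q QQ QX] := real_spectral symX EX.
have lt (i : 'I_p) : (a + i < n)%N by have := ltn_ord i; lia.
pose f i := Ordinal (lt i).
have VV : rowsub f Q *m (rowsub f Q)^T = 1%:M.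
  rewrite trmx_mxsub -mxsub_mul QQ.
  by apply/matrixP => i j; rewrite !mxE -!val_eqE /= eqn_add2l.
have VXV : rowsub f Q *m X *m (rowsub f Q)^T =
    diag_mx (\row_(i < p) eigval (a + i).+1 X).
  rewrite trmx_mxsub mul_rowsub_mx -mxsub_mul QX.
  by apply/matrixP => i j; rewrite !mxE -!val_eqE /= eqn_add2l.
exists (rowsub f Q).
  by apply/row_freeP; exists (rowsub f Q)^T.
move=> w; split.
  by rewrite dot_mull -mulmxA VV mulmx1.
rewrite /dot trmx_mul !mulmxA -!(mulmxA w) mulmxA VXV mxE.
by apply: eq_bigr => i _; rewrite mul_mx_diag !mxE mulrAC mulrC.
Qed.

(** By dimension count, the row space of [V] meets the span of the eigenvectors numbered [j] to [n],
    where the Rayleigh quotient is at most the [j]-th eigenvalue. *)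
Lemma eigval_ge (R : realType) n (X : 'M[R]_n) j p (V : 'M_(p, n)) c :
  X^T = X -> (0 < j)%N -> (j <= p)%N -> row_free V ->
  (forall w, c * dot (w *m V) (w *m V) <= dot (w *m V *m X) (w *m V)) ->
  c <= eigval j X.
Proof.
move=> symX j0 jp fV cV.
have pn : (p <= n)%N by rewrite -(eqP fV) rank_leq_col.
have [|U fU qU] := @eigval_rows _ _ X j.-1 (n - j.-1) symX; first lia.
have [|w [w' [e nz]]] := rows_intersect fV fU; first lia.
have := cV w; move: nz; rewrite -dot_gt0 e => nz h.
have [n1 qw] := qU w'.
rewrite -(ler_pM2r nz); apply: le_trans h _.
rewrite qw n1 dotE mulr_sumr ler_sum // => i _.
rewrite -expr2 ler_wpM2r ?sqr_ge0 // eigval_noninc //; have := ltn_ord i; lia.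
Qed.

(** Dually, the row space of [V] meets the span of the leading [j] eigenvectors, where the Rayleigh
    quotient is at least the [j]-th eigenvalue. *)
Lemma eigval_le (R : realType) n (X : 'M[R]_n) j p (V : 'M_(p, n)) c :
  X^T = X -> (0 < j)%N -> (j <= n)%N -> (n < p + j)%N -> row_free V ->
  (forall w, dot (w *m V *m X) (w *m V) <= c * dot (w *m V) (w *m V)) ->
  eigval j X <= c.
Proof.
move=> symX j0 jn pj fV cV.
have [|U fU qU] := @eigval_rows _ _ X 0 j symX; first lia.
have [|w [w' [e nz]]] := rows_intersect fV fU; first lia.
have := cV w; move: nz; rewrite -dot_gt0 e => nz h.
have [n1 qw] := qU w'.
rewrite -(ler_pM2r nz); apply: le_trans h.
rewrite qw n1 dotE mulr_sumr ler_sum // => i _.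
rewrite -expr2 ler_wpM2r ?sqr_ge0 // eigval_noninc //; have := ltn_ord i; lia.
Qed.

(** This subspace serves as a test space for a second matrix in [eigval_ge]. *)
Lemma eigval_attained (R : realType) n (X : 'M[R]_n) j : X^T = X ->
  (j <= n)%N ->
  exists2 V : 'M[R]_(j, n), row_free V &
    forall w, eigval j X * dot (w *m V) (w *m V) <= dot (w *m V *m X) (w *m V).
Proof.
move=> symX jn; have [//|V fV qV] := @eigval_rows _ _ X 0 j symX.
exists V => // w; have [n1 qw] := qV w.
rewrite qw n1 dotE mulr_sumr ler_sum // => i _.
rewrite -expr2 ler_wpM2r ?sqr_ge0 // eigval_noninc //; have := ltn_ord i; lia.
Qed.

(* The subspace [V M] carries the bound for [M M^T] over to [M^T M]:
   by Cauchy-Schwarz, [|u M M^T|^2 |u|^2 >= |u M|^4]. *)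
Lemma eigval_gram_ge (R : realType) p n (M : 'M[R]_(n, p)) j (V : 'M_(j, n)) c :
  (0 < j)%N -> 0 < c -> row_free V ->
  (forall w, c * dot (w *m V) (w *m V) <= dot (w *m V *m M) (w *m V *m M)) ->
  c <= eigval j (M^T *m M).
Proof.
move=> j0 c0 fV cV.
apply: (@eigval_ge _ _ _ _ j (V *m M)) => //.
- by rewrite trmx_mul trmxK.
- apply: inj_row_free => w; rewrite mulmxA => w0.
  have := cV w; rewrite w0 dot0l pmulr_rle0 // => h.
  have : dot (w *m V) (w *m V) == 0 by rewrite eq_le h dot_ge0.
  by rewrite dot_eq0 -(mul0mx _ V) => /eqP /(row_free_inj fV).
move=> w; rewrite !mulmxA; set u := w *m V.
have [->|u0] := eqVneq u 0; first by rewrite !mul0mx !dot0l mulr0.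
rewrite (dot_mull (u *m M *m M^T)).
have := dot_CauchySchwarz (u *m M *m M^T) u.
have -> : dot (u *m M *m M^T) u = dot (u *m M) (u *m M).
  by rewrite dot_mull trmxK.
have := cV w; rewrite -/u.
set a := dot u u; set b := dot (u *m M) (u *m M).
have a0 : 0 < a by rewrite dot_gt0.
move=> ab bb; rewrite -(ler_pM2r a0); apply: le_trans bb.
by rewrite mulrAC expr2 ler_wpM2r ?dot_ge0.
Qed.

(** * Frobenius, column and spectral norms *)

Definition frob (R : realType) m n (M : 'M[R]_(m, n)) : R :=
  \sum_i \sum_j M i j ^+ 2.

Lemma frob_tr (R : realType) m n (M : 'M[R]_(m, n)) : frob M^T = frob M.
Proof.
rewrite /frob exchange_big; apply: eq_bigr => i _; apply: eq_bigr => j _.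
by rewrite mxE.
Qed.

(** Cauchy-Schwarz against each column of [M], then summation over the columns. *)
Lemma dot_mul_frob (R : realType) m n (M : 'M[R]_(m, n)) u :
  dot (u *m M) (u *m M) <= frob M * dot u u.
Proof.
rewrite dotE -frob_tr /frob mulr_suml ler_sum // => j _.
have -> : (u *m M) 0 j = dot u (row j M^T).
  by rewrite dotE mxE; apply: eq_bigr => i _; rewrite !mxE.
rewrite -expr2; apply: le_trans (dot_CauchySchwarz _ _) _.
rewrite mulrC ler_wpM2r ?dot_ge0 // dotE.
by rewrite ler_sum // => i _; rewrite mxE expr2.
Qed.

Lemma norm2_sqr (R : realType) n (v : 'cV[R]_n) : norm2 v ^+ 2 = dot v^T v^T.
Proof.
rewrite /norm2 sqr_sqrtr ?dotE ?sumr_ge0 // => [|i _]; last exact: sqr_ge0.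
by apply: eq_bigr => i _; rewrite !mxE expr2.
Qed.

Lemma norm2_ge0 (R : realType) n (v : 'cV[R]_n) : 0 <= norm2 v.
Proof. exact: sqrtr_ge0. Qed.

Lemma frob_le_norm21 (R : realType) m n (M : 'M[R]_(m, n)) :
  frob M <= n%:R * norm21 M ^+ 2.
Proof.
rewrite -frob_tr /frob -[n in n%:R]card_ord -sum1_card natr_sum mulr_suml.
apply: ler_sum => j _; rewrite mul1r.
have -> : \sum_i M^T j i ^+ 2 = norm2 (col j M) ^+ 2.
  by rewrite norm2_sqr dotE; apply: eq_bigr => i _; rewrite !mxE expr2.
have h : norm2 (col j M) <= norm21 M by rewrite /norm21 le_bigmax.
by rewrite lerXn2r // ?nnegrE ?norm2_ge0 // (le_trans _ h) ?norm2_ge0.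
Qed.

Lemma spectral_norm_le (R : realType) m n (M : 'M[R]_(m, n)) c : 0 <= c ->
  (forall u, dot (u *m M^T) (u *m M^T) <= c ^+ 2 * dot u u) ->
  spectral_norm M <= c.
Proof.
move=> c0 cM; apply: ge_sup.
  exists (norm2 (M *m 0)), 0 => //=.
  by rewrite /norm2 big1 ?sqrtr0 // => i _; rewrite mxE expr0n.
move=> _ [v /= v1 <-].
rewrite -(@ler_pXn2r _ 2) ?nnegrE ?norm2_ge0 // norm2_sqr trmx_mul.
apply: le_trans (cM _) _; rewrite -norm2_sqr ler_piMr ?sqr_ge0 //.
by rewrite expr_le1 ?norm2_ge0.
Qed.

Lemma spectral_norm_ge (R : realType) m n (M : 'M[R]_(m, n)) v :
  norm2 (M *m v) <= spectral_norm M * norm2 v.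
Proof.
(* The matrix [N] is generic: it is taken to be [M] and, for the norm of the vector itself, the
   identity. *)
have norm2Z a (x : 'cV[R]_n) p (N : 'M[R]_(p, n)) : 0 <= a ->
    norm2 (N *m (a *: x)) = a * norm2 (N *m x).
  move=> a0; apply/eqP; rewrite -(@eqrXn2 _ 2) ?mulr_ge0 ?norm2_ge0 //.
  by rewrite exprMn !norm2_sqr -scalemxAr linearZ /= dotZl dotC dotZl mulrA.
(* A [sup] dominates its set only when the set is bounded; the Frobenius norm supplies a bound. *)
have ub : has_ubound [set norm2 (M *m v) | v in [set v : 'cV[R]_n | norm2 v <= 1]].
  exists (Num.sqrt (frob M)) => _ [x /= x1 <-].
  have f0 : 0 <= frob M by do 2![apply: sumr_ge0 => ? _]; exact: sqr_ge0.
  rewrite -(@ler_pXn2r _ 2) ?nnegrE ?norm2_ge0 ?sqrtr_ge0 // norm2_sqr.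
  rewrite trmx_mul sqr_sqrtr //.
  apply: le_trans (dot_mul_frob _ _) _.
  by rewrite frob_tr -norm2_sqr ler_piMr // expr_le1 ?norm2_ge0.
have [v0|v0] := eqVneq (norm2 v) 0.
  have : dot v^T v^T == 0 by rewrite -norm2_sqr v0 expr0n.
  rewrite dot_eq0 => /eqP vT0; rewrite v0 mulr0 -(trmxK v) vT0 trmx0 mulmx0.
  by rewrite /norm2 big1 ?sqrtr0 // => i _; rewrite mxE expr0n.
have vp : 0 < norm2 v by rewrite lt0r v0 norm2_ge0.
rewrite -ler_pdivrMr // mulrC -norm2Z ?invr_ge0 ?norm2_ge0 //.
rewrite /spectral_norm; apply: (ub_le_sup ub).
exists ((norm2 v)^-1 *: v) => //=.
by rewrite -[_ *: v]mul1mx norm2Z ?invr_ge0 ?norm2_ge0 // mul1mx mulVf.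
Qed.

Lemma quadratic_le_spectral_norm (R : realType) n (M : 'M[R]_n) u :
  dot (u *m M) u <= spectral_norm M * dot u u.
Proof.
apply: (@le_trans _ _ (norm2 (M *m u^T) * norm2 u^T)); last first.
  rewrite -[in X in _ <= X](trmxK u) -norm2_sqr expr2 mulrA.
  by rewrite ler_wpM2r ?norm2_ge0 // spectral_norm_ge.
apply: le_trans (ler_norm _) _.
rewrite -(@ler_pXn2r _ 2) ?nnegrE ?mulr_ge0 ?norm2_ge0 //.
rewrite real_normK ?num_real // exprMn !norm2_sqr trmxK trmx_mul trmxK.
by rewrite (dot_mull u M) [leRHS]mulrC; exact: dot_CauchySchwarz.
Qed.

(** * Comparison of eigenvalues of related matrices *)

Lemma eigval_gram_swap (R : realType) n p (M : 'M[R]_(n, p)) j :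
  (0 < j)%N -> (j <= n)%N -> 0 < eigval j (M *m M^T) ->
  eigval j (M *m M^T) <= eigval j (M^T *m M).
Proof.
move=> j0 jn lam0.
have symH : (M *m M^T)^T = M *m M^T by rewrite trmx_mul trmxK.
have [V fV qV] := eigval_attained symH jn.
apply: (eigval_gram_ge j0 lam0 fV) => w; apply: le_trans (qV w) _.
by rewrite mulmxA dot_mull trmxK.
Qed.

(** Weyl's inequality in one-sided form: the space attaining the [j]-th eigenvalue of [X] is tested
    on [Y]. Semidefinite differences are covered by [d = 0]. *)
Lemma eigval_perturb (R : realType) n (X Y : 'M[R]_n) j d :
  X^T = X -> Y^T = Y -> (0 < j)%N -> (j <= n)%N ->
  (forall u, dot (u *m X) u <= dot (u *m Y) u + d * dot u u) ->
  eigval j X <= eigval j Y + d.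
Proof.
move=> symX symY j0 jn XY; have [V fV qV] := eigval_attained symX jn.
rewrite -lerBlDr; apply: (eigval_ge symY j0 (leqnn j) fV) => w.
by rewrite mulrBl lerBlDr (le_trans (qV w)).
Qed.

(** Since [w = (w M) M^-1], a small inverse bounds the singular values of [M] from below. *)
Lemma dot_le_frob_invmx (R : realType) n (M : 'M[R]_n) w : M \in unitmx ->
  dot w w <= frob (invmx M) * dot (w *m M) (w *m M).
Proof. by move=> uM; have := dot_mul_frob (invmx M) (w *m M); rewrite mulmxK. Qed.

Lemma frob_le_mx_norm (R : realType) n (M : 'M[R]_n) :
  frob M <= (n%:R * mx_norm M) ^+ 2.
Proof.
have h i j : M i j ^+ 2 <= mx_norm M ^+ 2.
  have : `|M i j| <= mx_norm M.
    by rewrite mx_normrE; apply: (le_bigmax _ (fun ij => `|M ij.1 ij.2|) (i, j)).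
  move=> Mij; rewrite -(real_normK (num_real _)).
  by apply: lerXn2r; rewrite // nnegrE ?normr_ge0 // (le_trans _ Mij).
apply: (@le_trans _ _ (\sum_(i < n) \sum_(j < n) mx_norm M ^+ 2)).
  by apply: ler_sum => i _; apply: ler_sum.
by rewrite !sumr_const !card_ord -mulrnA exprMn -natrX -mulnn mulr_natl.
Qed.

(** [eigvals] depends only on the characteristic polynomial, which similarity preserves. *)
Lemma eigval_perm (R : realType) n (A P : 'M[R]_n) j : is_perm_mx P ->
  eigval j (P^T *m A *m P) = eigval j A.
Proof.
move=> /is_perm_mxP [s ->]; rewrite /eigval /eigvals char_poly_conj //.
by rewrite tr_perm_mx -perm_mxM mulVg perm_mx1.
Qed.

(** * Block computations and the final arithmetic *)

Lemma mul_row_trailing_block (R : realType) p q (S : 'M[R]_q) (x : 'rV[R]_p) y :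
  row_mx x y *m block_mx 0 0 0 S = row_mx (0 : 'rV_p) (y *m S).
Proof. by rewrite mul_row_block !mulmx0 !add0r. Qed.

(** The leading [(k+1)]-block of [P^T A P] equals [M M^T], expressed through vectors supported on
    the first [k + 1] coordinates. *)
Lemma pivot_head_quadratic (R : realType) (k m : nat)
    (L11 : 'M[R]_k) (l : 'cV[R]_k) (L21 : 'M[R]_(m, k))
    (alpha : R) (s : 'cV[R]_m) (Shat : 'M[R]_m)
    (x : 'rV[R]_k) (y : 'rV[R]_1) : 0 <= alpha ->
  let L := col_mx L11 (col_mx l^T L21) in
  let E := block_mx 0 0 0 (block_mx alpha%:M s^T s Shat) in
  let u := row_mx x (row_mx y 0) in
  let w := row_mx x y *m block_mx L11 0 l^T (Num.sqrt alpha)%:M in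
  dot (u *m (L *m L^T + E)) u = dot w w.
Proof.
move=> a0 L E u w.
have -> : w = row_mx (x *m L11 + y *m l^T) (y *m (Num.sqrt alpha)%:M).
  by rewrite /w mul_row_block mulmx0 add0r.
rewrite mulmxDr dotDl mulmxA (dot_mull (u *m L)) trmxK mul_row_trailing_block.
rewrite mul_row_block mul0mx addr0 /u /L !mul_row_col mul0mx !addr0.
rewrite mul0mx addr0 !dot_row_mx !dot0l [dot _ 0]dotC dot0l !add0r addr0; congr (_ + _).
by rewrite !mul_mx_scalar !dotZl [dot y (_ *: _)]dotC dotZl mulrA -expr2 sqr_sqrtr.
Qed.

(** Here [a], [b], [sig], [nu] stand for [lambda_j(A)], [lambda_(k+1)(A)], [sigma_j(L)^2] and the
    norm of the padded Schur complement. *)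
Lemma strong_rrchol_arith (R : realType) (a b sig nu c t : R) :
  0 < c -> c <= b -> c <= sig -> sig <= a -> a <= sig + nu -> 0 <= t -> nu <= t * c ->
  a / (1 + t * Num.min 1 ((1 + t) * (b / a))) <= sig.
Proof.
move=> c0 cb cs sa an t0 nt.
have a0 : 0 < a by lra.
have b0 : 0 < b by lra.
have s0 : 0 < sig by lra.
have q0 : 0 <= b / a by rewrite ltW // divr_gt0.
have m0 : 0 <= Num.min 1 ((1 + t) * (b / a)).
  by rewrite le_min ler01 mulr_ge0 // addr_ge0.
have tb : t * c <= t * b by rewrite ler_wpM2l.
have ts : t * c <= t * sig by rewrite ler_wpM2l.
rewrite ler_pdivrMr; last by rewrite ltr_pwDl // mulr_ge0.
have [_|_] := leP 1 ((1 + t) * (b / a)); first by lra.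
(* In [a <= sig + t b], the term [t b = t (b / a) a] is bounded by inserting the first alternative
   [a <= sig (1 + t)]. *)
have : t * (b / a) * a <= t * (b / a) * (sig * (1 + t)).
  by apply: ler_wpM2l; [exact: mulr_ge0|lra].
rewrite -[t * _ * a]mulrA divfK ?gt_eqF // => h.
have -> : sig * (1 + t * ((1 + t) * (b / a))) =
    sig + t * (b / a) * (sig * (1 + t)) by ring.
lra.
Qed.

(** * Eigenvalue and singular value bounds for the factorization *)

Theorem theorem1 (R : realType) (k m : nat)
    (A P : 'M[R]_(k + (1 + m)))
    (L : 'M[R]_(k + (1 + m), k)) (S : 'M[R]_(1 + m))
    (L11 : 'M[R]_k) (l : 'cV[R]_k) (L21 : 'M[R]_(m, k))
    (alpha : R) (s : 'cV[R]_m) (Shat : 'M[R]_m) (g : R)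
    (hk : (1 <= k)%N)
    (hA : sym_posdef A)
    (hL : L = col_mx L11 (col_mx l^T L21))
    (hS : S = block_mx alpha%:M s^T s Shat)
    (hchol : partial_cholesky A P L S)
    (halpha : alpha = mx_norm S)
    (hg : 1 < g)
    (hpivot : 1 / Num.sqrt alpha >=
      1 / Num.sqrt g *
        norm21 (invmx (block_mx L11 0 l^T (Num.sqrt alpha)%:M))) :
  exists tau : R,
    [/\ tau <= g * (1 + m)%:R * (k + 1)%:R,
        eigval (k + 1) A <= spectral_norm (P^T *m A *m P - L *m L^T),
        spectral_norm (P^T *m A *m P - L *m L^T) <= tau * eigval (k + 1) A &
        forall j : nat, (1 <= j <= k)%N ->
          eigval j A >= singval j L ^+ 2 /\
          singval j L ^+ 2 >=
            eigval j A /
              (1 + tau * Num.min 1 ((1 + tau) * (eigval (k + 1) A / eigval j A)))].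
Proof.
have [symA _] := hA; have [permP trigL diagL [symS posS] EB] := hchol.
set B := P^T *m A *m P in EB *; set E := block_mx 0 0 0 S in EB.
have -> : B - L *m L^T = E by rewrite EB addrC addKr.
have eB j : eigval j A = eigval j B by rewrite eigval_perm.
have symB : B^T = B by rewrite /B !trmx_mul symA trmxK mulmxA.
have symLL : (L *m L^T)^T = L *m L^T by rewrite trmx_mul trmxK.
have symG : (L^T *m L)^T = L^T *m L by rewrite trmx_mul trmxK.
have a0 : 0 < alpha.
  (* The pivot is the value of the form [S] at the first basis vector. *)
  pose e : 'rV[R]_(1 + m) := row_mx 1%:M 0.
  have := posS e^T; rewrite trmxK hS mul_row_block !mul1mx !mul0mx !addr0.
  rewrite tr_row_mx mul_row_col trmx0 mulmx0 addr0 trmx1 mulmx1 mxE mulr1n; apply.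
  rewrite -col_mx0; apply/eqP => /eq_col_mx [/matrixP /(_ 0 0) + _].
  by rewrite !mxE => /eqP; rewrite oner_eq0.
have sa0 : 0 < Num.sqrt alpha by rewrite sqrtr_gt0.
have g0 : 0 < g by lra.
set M := block_mx L11 0 l^T (Num.sqrt alpha)%:M in hpivot.
have uM : M \in unitmx.
  rewrite unitmxE det_lblock det_scalar1 unitfE mulf_neq0 ?gt_eqF //.
  have -> : L11 = usubmx L by rewrite hL col_mxKu.
  by rewrite det_trig // prodr_gt0.
have k1 : 0 < (k + 1)%:R :> R by rewrite ltr0n addn1.
pose c := alpha / (g * (k + 1)%:R).
have c0 : 0 < c by rewrite divr_gt0 // mulr_gt0.
(* The pivot condition, squared, bounds each of the [k + 1] columns of [M^-1] by [g / alpha]. *)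
have fN : frob (invmx M) <= c^-1.
  apply: le_trans (frob_le_norm21 _) _.
  have n0 : 0 <= norm21 (invmx M).
    rewrite /norm21; elim/big_ind: _ => // [x y x0 y0|i _].
      by rewrite le_max x0.
    exact: norm2_ge0.
  have sg0 : 0 < Num.sqrt g by rewrite sqrtr_gt0.
  have : norm21 (invmx M) <= Num.sqrt g / Num.sqrt alpha.
    by move: hpivot; rewrite mulrAC mul1r ler_pdivrMr // mul1r mulrC.
  move=> /(lerXn2r 2); rewrite !nnegrE => /(_ n0 (divr_ge0 (sqrtr_ge0 _) (sqrtr_ge0 _))).
  rewrite expr_div_n (sqr_sqrtr (ltW g0)) (sqr_sqrtr (ltW a0)) => h.
  by rewrite /c invf_div [leRHS]mulrAC [leRHS]mulrC ler_wpM2l ?ler0n.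
(* Stated for a generic [N], since both [M] and [M^T] occur below. *)
have cM (N : 'M[R]_(k + 1)) w : N \in unitmx -> frob (invmx N) <= c^-1 ->
    c * dot w w <= dot (w *m N) (w *m N).
  move=> uN hN; rewrite mulrC -ler_pdivlMr // mulrC.
  by apply: le_trans (dot_le_frob_invmx _ uN) _; rewrite ler_wpM2r ?dot_ge0.
pose t := g * (1 + m)%:R * (k + 1)%:R.
have tc : t * c = (1 + m)%:R * alpha.
  by rewrite /t /c; field; rewrite natr1 pnatr_eq0 (gt_eqF g0).
(* The [(1 + m)^2] entries of [S] are at most [alpha] in absolute value. *)
have nuS : spectral_norm E <= t * c.
  rewrite tc; apply: spectral_norm_le => [|u]; first by rewrite mulr_ge0 // ltW.
  rewrite -[u]hsubmxK /E tr_block_mx !trmx0 symS mul_row_trailing_block.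
  rewrite !dot_row_mx dot0l add0r.
  apply: le_trans (dot_mul_frob _ _) _.
  apply: ler_pM => //; rewrite ?dot_ge0 //.
  - by do 2![apply: sumr_ge0 => ? _]; exact: sqr_ge0.
  - by rewrite halpha; exact: frob_le_mx_norm.
  - by rewrite lerDr dot_ge0.
have lamle : eigval (k + 1) B <= spectral_norm E.
  (* On the left kernel of [L], of dimension at least [1 + m], the matrix [B] acts as [E]. *)
  apply: (@eigval_le _ _ _ _ _ (row_base (kermx L))) => //; rewrite ?row_base_free //.
  - by rewrite addn1.
  - by rewrite leq_add2l.
  - by rewrite mxrank_ker; have := rank_leq_col L; clear; lia.
  move=> w; have -> : w *m row_base (kermx L) *m B = w *m row_base (kermx L) *m E.
    rewrite EB mulmxDr mulmxA.
    have /sub_kermxP -> : (w *m row_base (kermx L) <= kermx L)%MS.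
      by rewrite (submx_trans (submxMl _ _)) ?eq_row_base.
    by rewrite mul0mx add0r.
  exact: quadratic_le_spectral_norm.
have lamge : c <= eigval (k + 1) B.
  pose V : 'M[R]_(k + 1, k + (1 + m)) := block_mx 1%:M 0 0 (row_mx 1%:M 0).
  have wV (w : 'rV_(k + 1)) : w *m V = row_mx (lsubmx w) (row_mx (rsubmx w) 0).
    rewrite -{1}[w]hsubmxK mul_row_block !mulmx0 addr0 add0r mulmx1.
    by rewrite mul_mx_row mulmx1 mulmx0.
  have dV w : dot (w *m V) (w *m V) = dot w w.
    by rewrite wV !dot_row_mx dot0l addr0 -dot_row_mx hsubmxK.
  apply: (@eigval_ge _ _ _ _ _ V) => //; first by rewrite addn1.
    apply: inj_row_free => w w0; apply/eqP; rewrite -dot_eq0 -dV w0 dot0l //.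
  move=> w; rewrite dV wV EB /E hS hL.
  rewrite (pivot_head_quadratic _ _ _ _ _ _ _ (ltW a0)) hsubmxK.
  exact: cM.
have sigge j : (1 <= j <= k)%N -> c <= eigval j (L^T *m L).
  move=> /andP[j1 jk].
  apply: (@eigval_ge _ _ _ _ _ 1%:M) => //; first by rewrite row_free_unit unitmx1.
  move=> w; rewrite mulmx1 mulmxA (dot_mull (w *m L^T)).
  (* The row [(w, 0) M^T] is the leading part of [w L^T], so its norm is no larger. *)
  have uMT : M^T \in unitmx by rewrite unitmx_tr.
  have := @cM M^T (row_mx w 0) uMT.
  rewrite -trmx_inv frob_tr => /(_ fN).
  rewrite dot_row_mx dot0l addr0 => /le_trans; apply.
  rewrite /M hL tr_block_mx !tr_col_mx !mul_mx_row mul_row_block trmxK !mul0mx !addr0.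
  by rewrite !dot_row_mx addrA lerDl dot_ge0.
(* [E] is positive semidefinite, so adding it to [L L^T] lowers no eigenvalue. *)
have LLB u : dot (u *m (L *m L^T)) u <= dot (u *m B) u + 0 * dot u u.
  rewrite mul0r addr0 EB mulmxDr dotDl lerDl -[u]hsubmxK /E.
  rewrite mul_row_trailing_block dot_row_mx dot0l add0r.
  have [->|v0] := eqVneq (rsubmx u) 0; first by rewrite mul0mx dot0l.
  have := posS (rsubmx u)^T; rewrite trmxK -(inj_eq (@trmx_inj _ _ _)) trmxK trmx0.
  by move=> /(_ v0) /ltW.
have BLL u : dot (u *m B) u <= dot (u *m (L *m L^T)) u + spectral_norm E * dot u u.
  by rewrite EB mulmxDr dotDl lerD2l quadratic_le_spectral_norm.
exists t; rewrite !eB; split=> //.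
  apply: le_trans nuS _; rewrite ler_wpM2l // /t.
  by rewrite !mulr_ge0 // ltW.
move=> j hj; have /andP[j1 jk] := hj; rewrite !eB.
have cs := sigge _ hj.
have s0 : 0 < eigval j (L^T *m L) by exact: lt_le_trans cs.
have jn : (j <= k + (1 + m))%N by rewrite (leq_trans jk) ?leq_addr.
have -> : singval j L ^+ 2 = eigval j (L^T *m L) by rewrite /singval sqr_sqrtr // ltW.
(* Both Gram matrices share their [j]-th eigenvalue; this first inequality supplies the positivity
   that the second one requires. *)
have GL : eigval j (L^T *m L) <= eigval j (L *m L^T).
  by have := @eigval_gram_swap _ _ _ L^T j j1 jk; rewrite trmxK; apply.
have LG : eigval j (L *m L^T) <= eigval j (L^T *m L).
  by apply: eigval_gram_swap => //; exact: lt_le_trans GL.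
have LB := eigval_perturb symLL symB j1 jn LLB.
have BL := eigval_perturb symB symLL j1 jn BLL.
rewrite addr0 in LB; have GB := le_trans GL LB.
have BG : eigval j B <= eigval j (L^T *m L) + spectral_norm E.
  by apply: le_trans BL _; rewrite lerD2r.
have t0 : 0 <= t by rewrite /t !mulr_ge0 // ltW.
by split; [exact: GB|exact: (strong_rrchol_arith c0 lamge cs GB BG t0 nuS)].
Qed.
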